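(* Let $p\in\mathcal{P}$ and $k>0$. Define a sequence $(x^l)_{l\in\mathbb{N}}$ in $\mathcal{R}$ by $x^0=0$ and $x^l=x^{l-1}+elo_k^{cl}(x^{l-1},p)$ for $l\in\mathbb{N}\setminus\{0\}$ (the classical Elo ratings obtained when the competition result $p$ is repeated in every period). If the sequence $(x^l)_{l\in\mathbb{N}}$ converges to a rating $x\in\mathcal{R}$, then $$x=\lim_{l\rightarrow\infty}elo_l(p)=\lim_{l\rightarrow\infty}elo_k(l\cdot p).$$
   Context: Fix $n\in\mathbb{N}$ with $n\geq 2$ and identify $n=\{0,1,\dots,n-1\}$ (so $i\in n$ means $0\le i\le n-1$). $\mathbb{N}$ includes $0$. The rating space is $\mathcal{R}:=\{x\in\mathbb{R}^n\mid\sum_{i\in n}x_i=0\}$, with norm $\lVert\cdot\rVert_1$. The space of competition results is $\mathcal{P}:=\{p\in\mathbb{R}^{n\times n}\mid p_{ij}\geq 0\text{ for all }i,j\in n,\ p_{ii}=0\text{ for all }i\in n\}$. For $k>0$, the classical Elo map is $$elo_k^{cl}:\mathcal{R}\times\mathcal{P}\rightarrow\mathcal{R},\quad (x,p)\mapsto k\cdot\left(\sum_{j\in n}\left(p_{ij}-\frac{p_{ij}+p_{ji}}{1+\exp(x_j-x_i)}\right)\right)_{i\in n}.$$ For every $k>0$ and $p\in\mathcal{P}$ there is exactly one $x\in\mathcal{R}$ with $x=elo_k^{cl}(x,p)$; it is denoted $elo_k(p)$ (the self-justifying rating with respect to $p$ and $k$). *)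

(* Defs.v *)
From HB Require Import structures.
From mathcomp Require Import all_boot all_order all_algebra.
From mathcomp Require Import all_classical all_reals all_analysis.
From mathcomp Require Import ring.

Set Implicit Arguments.
Unset Strict Implicit.
Unset Printing Implicit Defensive.

Import Order.TTheory GRing.Theory Num.Theory.
Import numFieldNormedType.Exports.

Local Open Scope classical_set_scope.
Local Open Scope ring_scope.

Definition ratings (R : realType) (n : nat) : set 'rV[R]_n :=
  [set x | \sum_(i < n) x ord0 i = 0].

Definition results (R : realType) (n : nat) : set 'M[R]_n :=
  [set p | (forall i j, 0 <= p i j) /\ (forall i, p i i = 0)].

(* The norm that MathComp-Analysis puts on 'rV[R]_n is the maximum norm, hence
   an explicit definition of the 1-norm and of convergence with respect to it;
   [cvg1P] below compares it with the library's notion. *)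
Definition norm1 (R : realType) (n : nat) (x : 'rV[R]_n) : R :=
  \sum_(i < n) `|x ord0 i|.

Definition cvg1 (R : realType) (n : nat) (u : nat -> 'rV[R]_n) (x : 'rV[R]_n)
    : Prop :=
  norm1 (u l - x) @[l --> \oo] --> (0 : R).

Definition elo_cl (R : realType) (n : nat) (k : R) (x : 'rV[R]_n) (p : 'M[R]_n)
    : 'rV[R]_n :=
  k *: \row_(i < n) \sum_(j < n)
    (p i j - (p i j + p j i) / (1 + expR (x ord0 j - x ord0 i))).

(* For 0 < k and p in [results] exactly one rating satisfies the fixed point
   equation, and [xget] selects it; the default value 0 is irrelevant then. *)
Definition elo (R : realType) (n : nat) (k : R) (p : 'M[R]_n) : 'rV[R]_n :=
  xget 0 [set x | ratings x /\ x = elo_cl k x p].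

Lemma elo_cl_rating (R : realType) (n : nat) (k : R) (x : 'rV[R]_n)
    (p : 'M[R]_n) : ratings (elo_cl k x p).
Proof.
rewrite /ratings /elo_cl /=.
under eq_bigr do rewrite !mxE.
rewrite -mulr_sumr.
set S := (X in k * X).
suff : S + S = 0.
  by rewrite -mulr2n => /eqP; rewrite mulrn_eq0 /= => /eqP ->; rewrite mulr0.
rewrite {2}/S exchange_big /S -big_split big1// => i _.
rewrite -big_split big1// => j _ /=.
have -> : expR (x ord0 i - x ord0 j) = (expR (x ord0 j - x ord0 i))^-1.
  by rewrite -expRN opprB.
set e := expR _.
have e0 : 0 < e by exact: expR_gt0.
have h1 : 1 + e != 0 by rewrite gt_eqF// addr_gt0.
have h2 : e + 1 != 0 by rewrite addrC.
by field; rewrite ?h1 ?h2 ?(lt0r_neq0 e0).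
Qed.

Lemma cvg1P (R : realType) (n : nat) (u : nat -> 'rV[R]_n) (x : 'rV[R]_n) :
  cvg1 u x <-> u @ \oo --> x.
Proof.
split => [ux|ux].
- apply/cvgrPdist_lt => e e0; move/cvgrPdist_lt : ux => /(_ e e0).
  apply: filterS => l; rewrite sub0r normrN => h.
  rewrite distrC (le_lt_trans _ h)// -[leLHS]/(mx_norm (u l - x)).
  have [->|/mx_norm_neq0[[i j] -> /=]] := eqVneq (mx_norm (u l - x)) 0 => //.
  rewrite (ord1 i) (le_trans _ (ler_norm _))// /norm1 (bigD1 j)//=.
  by rewrite lerDl sumr_ge0.
- rewrite /cvg1 /norm1.
  rewrite [X in _ --> X](_ : _ = \sum_(i < n) 0); last by rewrite big1.
  apply: cvg_big => [|i _]; first exact: add_continuous.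
  have h : (u l - x) ord0 i @[l --> \oo] --> x ord0 i - x ord0 i.
    under eq_fun do rewrite !mxE.
    apply: cvgB; last exact: cvg_cst.
    exact: (cvg_comp _ _ ux (@coord_continuous _ _ _ ord0 i x)).
  by move/cvg_norm: h; rewrite subrr normr0.
Qed.

(* Main.v *)
(* Write [F x = elo_cl 1 x p]; it is the gradient of a concave function, so
   [- F] is monotone. A convergent sequence [u] has a limit [x] with [F x = 0],
   while both [elo l p] and [elo k (l *: p)] are solutions [y] of [y = t F y]
   with [t] proportional to [l]. Monotonicity gives [<y, y - x> <= 0], hence a
   uniform bound on [y], and then, the logistic function being strongly
   monotone on bounded sets, [a_ij ((y - x)_i - (y - x)_j)^2 = O(1 / t)] with
   [a = p + p^T]. Zeros of [F] are unique only up to a shift on each connected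
   component of the graph of [a]; but [F], hence [y], every [u l] and [x], sums
   to zero on each component, which forces [y - x] to 0. *)
Require Import Defs.
From HB Require Import structures.
From mathcomp Require Import all_boot all_order all_algebra.
From mathcomp Require Import all_classical all_reals all_analysis.
From mathcomp Require Import ring lra.

Set Implicit Arguments.
Unset Strict Implicit.
Unset Printing Implicit Defensive.

Import Order.TTheory GRing.Theory Num.Theory.
Import numFieldNormedType.Exports.
Local Open Scope classical_set_scope.
Local Open Scope ring_scope.

(** Makes matrices a complete normed space, as Banach's fixed point theorem requires. *)
HB.instance Definition _ (R : realType) (m n : nat) :=
  Complete.on 'M[R]_(m, n).

Lemma mx_norm_le (R : realType) (m n : nat) (A : 'M[R]_(m, n)) (c : R) :
  0 <= c -> (forall i j, `|A i j| <= c) -> `|A| <= c.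
Proof.
move=> c0 Ac; rewrite -[leLHS]/(mx_norm A).
by have [->//|/mx_norm_neq0[[i j] ->]] := eqVneq (mx_norm A) 0.
Qed.

Lemma coord_le_norm (R : realType) (m n : nat) (A : 'M[R]_(m, n)) i j :
  `|A i j| <= `|A|.
Proof.
rewrite -[leRHS]/(mx_norm A) mx_normrE.
exact: (le_bigmax _ (fun ij : 'I_m * 'I_n => `|A ij.1 ij.2|) (i, j)).
Qed.

Lemma rowB (R : realType) (n : nat) (y z : 'rV[R]_n) i :
  (y - z) ord0 i = y ord0 i - z ord0 i.
Proof. by rewrite !mxE. Qed.

(** * Monotonicity of the logistic function *)

(* [t] is the opponent's rating minus one's own. *)
Definition winprob (R : realType) (t : R) : R := (1 + expR t)^-1.

Lemma winprobB (R : realType) (s t : R) :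
  winprob s - winprob t =
  (expR t - expR s) / ((1 + expR s) * (1 + expR t)).
Proof.
have := expR_gt0 s; have := expR_gt0 t => t0 s0.
have /lt0r_neq0 hs : 0 < 1 + expR s by rewrite addr_gt0.
have /lt0r_neq0 ht : 0 < 1 + expR t by rewrite addr_gt0.
by rewrite /winprob; field; rewrite hs ht.
Qed.

(** The numerator in [winprobB] is at most [(t - s) * expR t], the denominator at least [expR t].
    The case [c = 0] is monotonicity. *)
Lemma winprob_lip (R : realType) (s t c : R) :
  0 <= c -> t - s <= c -> winprob s - winprob t <= c.
Proof.
move=> c0 tsc; rewrite winprobB.
have s0 := expR_gt0 s; have t0 := expR_gt0 t.
rewrite ler_pdivrMr ?mulr_gt0 ?addr_gt0//.
have : expR t * (1 + (s - t)) <= expR s.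
  by rewrite -{2}[s](subrKC t) expRD ler_pM2l// expR_ge1Dx.
have : 0 <= expR s * expR t by rewrite mulr_ge0// ltW.
nra.
Qed.

(** For [s <= t] the numerator in [winprobB] is at least [expR (- M) * (t - s)], the denominator at
    most [(1 + expR M) ^+ 2]. *)
Lemma winprob_strong (R : realType) (M s t : R) :
  `|s| <= M -> `|t| <= M ->
  expR (- M) / (1 + expR M) ^+ 2 * (t - s) ^+ 2 <=
  (winprob s - winprob t) * (t - s).
Proof.
move=> sM tM; wlog st : s t sM tM / s <= t => [H|].
  have [|/ltW ts] := leP s t; first exact: H.
  by rewrite -[(t - s) ^+ 2]sqrrN -[leRHS]mulrNN !opprB; exact: H.
have eE (r : R) : `|r| <= M -> 1 + expR r <= 1 + expR M.
  by move=> rM; rewrite lerD2l ler_expR (le_trans (ler_norm _)).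
have s0 := expR_gt0 s; have t0 := expR_gt0 t; have M0 := expR_gt0 M.
rewrite [(t - s) ^+ 2]expr2 mulrA ler_wpM2r ?subr_ge0// winprobB mulrAC.
rewrite ler_pM ?mulr_ge0 ?invr_ge0 ?sqr_ge0 ?subr_ge0 ?expR_ge0//.
  have h : expR (- M) <= expR s.
    by rewrite ler_expR lerNl (le_trans (ler_norm _))// normrN.
  have : expR s * (1 + (t - s)) <= expR t.
    by rewrite -{2}[t](subrKC s) expRD ler_pM2l// expR_ge1Dx.
  nra.
by rewrite lef_pV2 ?posrE ?mulr_gt0 ?exprn_gt0 ?addr_gt0// expr2 ler_pM ?eE
  ?addr_ge0 ?expR_ge0.
Qed.

(** * Pairwise surpluses and summation by parts *)

Definition surplus (R : realType) (n : nat) (p : 'M[R]_n) (x : 'rV[R]_n)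
  (i j : 'I_n) : R :=
  p i j - (p i j + p j i) * winprob (x ord0 j - x ord0 i).

Lemma elo_clE (R : realType) (n : nat) (k : R) (x : 'rV[R]_n) (p : 'M[R]_n) i :
  elo_cl k x p ord0 i = k * \sum_j surplus p x i j.
Proof. by rewrite !mxE. Qed.

Lemma surplusC (R : realType) (n : nat) (p : 'M[R]_n) (x : 'rV[R]_n) i j :
  surplus p x j i = - surplus p x i j.
Proof.
rewrite /surplus /winprob -(opprB (x ord0 j)) expRN.
set e := expR _; have e0 : 0 < e by exact: expR_gt0.
have h1 : 1 + e != 0 by rewrite gt_eqF// addr_gt0.
have h2 : e + 1 != 0 by rewrite addrC.
by field; rewrite ?h1 ?h2 ?(lt0r_neq0 e0).
Qed.

(** Summation by parts on a graph; exchanging the two players gives the second half of the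
    right-hand side, hence the factor 2. *)
Lemma sum_antisym (R : realType) (n : nat) (v : 'I_n -> R)
    (s : 'I_n -> 'I_n -> R) : (forall i j, s j i = - s i j) ->
  2 * \sum_i v i * \sum_j s i j = \sum_i \sum_j (v i - v j) * s i j.
Proof.
move=> sC; have -> : \sum_i \sum_j (v i - v j) * s i j =
    \sum_i \sum_j v i * s i j + \sum_i \sum_j v j * s j i.
  rewrite -big_split; apply: eq_bigr => i _; rewrite -big_split.
  by apply: eq_bigr => j _ /=; rewrite [s j i]sC mulrBl mulrN.
rewrite [X in _ + X]exchange_big/= mulr_natl mulr2n.
by under eq_bigr do rewrite mulr_sumr.
Qed.

(** * Existence of self-justifying ratings *)

(* The damped map contracts the maximum norm: winprob is 1-Lipschitz, so with
   lam at least [t] times each row sum of [p + p^T] it is order preserving,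
   and it moves constants by the factor lam / (lam + 1). *)
Lemma elo_cl_fixpoint (R : realType) (n : nat) (t : R) (p : 'M[R]_n) :
  0 < t -> results p -> exists y, y = elo_cl t y p.
Proof.
move=> t0 [p0 _].
have a0 i j : 0 <= p i j + p j i by rewrite addr_ge0.
pose lam := t * \sum_i \sum_j (p i j + p j i).
have lam0 : 0 <= lam.
  by rewrite mulr_ge0 ?(ltW t0)// sumr_ge0// => i _; rewrite sumr_ge0.
have lam1 : 0 < lam + 1 by rewrite ltr_wpDl.
pose psi (y : 'rV[R]_n) := (lam + 1)^-1 *: (lam *: y + elo_cl t y p).
have psiE (y : 'rV[R]_n) i : psi y ord0 i =
    (lam + 1)^-1 * (lam * y ord0 i + t * \sum_j surplus p y i j).
  by rewrite -elo_clE !mxE.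
have psi_le (y z : 'rV[R]_n) i :
    (psi y - psi z) ord0 i <= lam / (lam + 1) * `|y - z|.
  pose m := `|y - z|; pose d (j : 'I_n) := y ord0 j - z ord0 j.
  have dm j : `|d j| <= m by have := coord_le_norm (y - z) ord0 j; rewrite rowB.
  have -> : (psi y - psi z) ord0 i = (lam + 1)^-1 *
      (lam * d i + t * \sum_j (surplus p y i j - surplus p z i j)).
    by rewrite rowB !psiE (sumrB _ _ (surplus p y i)) /d; ring.
  rewrite [leRHS]mulrAC [leLHS]mulrC ler_pM2r ?invr_gt0// -/m.
  (* The reserve [lam * (m - d i)] pays for the opponents: since [d j <= m], each adds at most its
     weight times [m - d i]. *)
  have -> : lam * m = lam * d i + lam * (m - d i) by ring.
  have mdi : 0 <= m - d i by rewrite subr_ge0 (le_trans (ler_norm _)).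
  rewrite lerD2l /lam -mulrA ler_wpM2l ?(ltW t0)//.
  rewrite (@le_trans _ _ (\sum_j (p i j + p j i) * (m - d i)))//.
    apply: ler_sum => j _.
    have -> : surplus p y i j - surplus p z i j = (p i j + p j i) *
        (winprob (z ord0 j - z ord0 i) - winprob (y ord0 j - y ord0 i)).
      by rewrite /surplus; ring.
    rewrite ler_wpM2l// winprob_lip//.
    have := le_trans (ler_norm _) (dm j); rewrite /d; lra.
  rewrite -mulr_suml ler_wpM2r// [leRHS](bigD1 i)//= lerDl.
  by rewrite sumr_ge0// => h _; rewrite sumr_ge0.
have q0 : 0 <= lam / (lam + 1) by rewrite divr_ge0// ltW.
have psi_ctr : is_contraction (totalfun psi).
  exists (NngNum q0); split; first by rewrite /= ltr_pdivrMr// mul1r ltrDl.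
  move=> [y z] _ /=; apply: mx_norm_le => [|a j]; first by rewrite mulr_ge0.
  rewrite (ord1 a) ler_norml psi_le andbT lerNl.
  by rewrite distrC rowB opprB -rowB psi_le.
have [||y _ yE] := banach_fixed_point psi_ctr.
- exact: closedT.
- by exists 0.
exists y; have : (lam + 1) *: y = lam *: y + elo_cl t y p.
  by rewrite {1}yE /= /psi scalerA mulfV ?scale1r// gt_eqF.
by rewrite scalerDl scale1r => /addrI.
Qed.

(** Values of [elo_cl] sum to zero, so any fixed point is a rating and [xget] does not fall back to
    its default. *)
Lemma elo_spec (R : realType) (n : nat) (t : R) (p : 'M[R]_n) :
  0 < t -> results p -> elo t p = elo_cl t (elo t p) p.
Proof.
move=> t0 hp; have [y yE] := elo_cl_fixpoint t0 hp.
rewrite /elo; case: xgetP => [z _ []//|].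
by move=> /(_ y)[]; split=> //; rewrite yE; exact: elo_cl_rating.
Qed.

(** [elo_cl] is linear in the results, so both sides select from the same set. *)
Lemma elo_scale (R : realType) (n : nat) (k l : R) (p : 'M[R]_n) :
  elo k (l *: p) = elo (k * l) p.
Proof.
rewrite /elo; congr xget; apply/seteqP.
suff E y : elo_cl k y (l *: p) = elo_cl (k * l) y p.
  by split=> y /=; rewrite E.
apply/rowP => i; rewrite !elo_clE -mulrA; congr (_ * _).
rewrite mulr_sumr; apply: eq_bigr => j _; rewrite /surplus !mxE; ring.
Qed.

(** For [v] the indicator of a component: no rating flows between components. A pair has [v i = v j]
    or, by nonnegativity, no results and hence no surplus. *)
Lemma surplus_conserved (R : realType) (n : nat) (p : 'M[R]_n) (x : 'rV[R]_n)
    (v : 'I_n -> R) :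
  results p -> (forall i j, 0 < p i j + p j i -> v i = v j) ->
  \sum_i v i * \sum_j surplus p x i j = 0.
Proof.
move=> [p0 _] vE.
have /eqP := sum_antisym v (surplusC p x).
rewrite [X in _ == X]big1 ?mulf_eq0 ?pnatr_eq0/= => [/eqP//|i _].
apply: big1 => j _; have := addr_ge0 (p0 i j) (p0 j i).
rewrite le_eqVlt => /predU1P[/esym a0|/vE->]; last by rewrite subrr mul0r.
have : p i j = 0 by have := p0 i j; have := p0 j i; lra.
by rewrite /surplus a0 => ->; ring.
Qed.

(** The inequality [t * S <= |x|^2 - |y|^2] in Euclidean norms serves twice: it bounds [y] by [x],
    making the strong monotonicity constant independent of [t], and it gives [S] the order
    [1 / t]. *)
Lemma dist_to_equilibrium (R : realType) (n : nat) (p : 'M[R]_n)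
    (x : 'rV[R]_n) :
  results p -> (forall i, \sum_j surplus p x i j = 0) ->
  exists K, forall t y, 0 < t -> y = elo_cl t y p -> forall i j,
    (p i j + p j i) *
      ((y ord0 i - x ord0 i) - (y ord0 j - x ord0 j)) ^+ 2 <= K / t.
Proof.
move=> [p0 _] Fx0; have a0 i j : 0 <= p i j + p j i by rewrite addr_ge0.
(* From [z_i^2 <= Q] follows [|z_i| <= 1 + Q] without a square root, so differences are at most [M];
   [c] is the constant of [winprob_strong]. *)
pose Q := \sum_i x ord0 i ^+ 2; pose M := 2 * (1 + Q).
pose c := expR (- M) / (1 + expR M) ^+ 2.
have c0 : 0 < c by rewrite divr_gt0 ?exprn_gt0 ?addr_gt0 ?expR_gt0.
have diffM (z : 'rV[R]_n) : \sum_i z ord0 i ^+ 2 <= Q ->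
    forall i j, `|z ord0 j - z ord0 i| <= M.
  move=> zQ; suff zM i : `|z ord0 i| <= 1 + Q.
    move=> i j; rewrite (le_trans (ler_normB _ _))//.
    by rewrite /M mulr_natl mulr2n lerD.
  have : z ord0 i ^+ 2 <= Q.
    rewrite (le_trans _ zQ)// (bigD1 i)//= lerDl sumr_ge0// => j _.
    by rewrite sqr_ge0.
  rewrite -real_normK ?num_real//; have := normr_ge0 (z ord0 i); nra.
exists (Q / c) => t y t0 yE i j.
pose d h := y ord0 h - x ord0 h; rewrite -/(d i) -/(d j).
pose W h l := (winprob (y ord0 l - y ord0 h) - winprob (x ord0 l - x ord0 h)) *
  (d h - d l).
have dE h l : d h - d l =
    (x ord0 l - x ord0 h) - (y ord0 l - y ord0 h) by rewrite /d; ring.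
have W0 h l : 0 <= W h l.
  (* [y] is not bounded yet, so the larger of the two absolute differences stands in for [M]. *)
  rewrite /W dE.
  have le1 := le_max `|y ord0 l - y ord0 h| `|y ord0 l - y ord0 h|
    `|x ord0 l - x ord0 h|.
  have le2 := le_max `|x ord0 l - x ord0 h| `|y ord0 l - y ord0 h|
    `|x ord0 l - x ord0 h|.
  rewrite lexx in le1; rewrite lexx orbT in le2.
  apply: le_trans (winprob_strong le1 le2).
  by rewrite mulr_ge0 ?sqr_ge0// divr_ge0 ?sqr_ge0 ?expR_ge0.
pose S := \sum_h \sum_l (p h l + p l h) * W h l.
(* Summation by parts at [x] and at [y]: the surplus sums of [x] vanish, those of [y] are
   [y / t]. *)
have SE : t * S = 2 * \sum_h (x ord0 h - y ord0 h) * y ord0 h.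
  have -> : S = - (2 * \sum_h d h * \sum_l surplus p y h l).
    have := sum_antisym d (surplusC p x).
    rewrite big1 => [|h _]; last by rewrite Fx0 mulr0.
    rewrite mulr0 (sum_antisym d (surplusC p y)) => /esym Dx.
    rewrite -[X in - X]subr0 -[X in - (_ - X)]Dx opprB /S -sumrB.
    apply: eq_bigr => h _; rewrite -sumrB; apply: eq_bigr => l _.
    by rewrite /W /surplus; ring.
  rewrite mulrN mulrCA -mulrN; congr (_ * _).
  rewrite mulr_sumr -sumrN; apply: eq_bigr => h _.
  have yh : y ord0 h = t * \sum_l surplus p y h l by rewrite -elo_clE -yE.
  by rewrite [X in _ = _ * X]yh /d; ring.
have S0 : 0 <= S.
  by rewrite sumr_ge0// => h _; rewrite sumr_ge0// => l _; rewrite mulr_ge0.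
have tSle : t * S <= Q - \sum_h y ord0 h ^+ 2.
  rewrite SE mulr_sumr /Q -sumrB; apply: ler_sum => h _.
  have := sqr_ge0 (x ord0 h - y ord0 h); nra.
have yQ : \sum_h y ord0 h ^+ 2 <= Q.
  by rewrite -subr_ge0 (le_trans _ tSle)// mulr_ge0// ltW.
have SQ : t * S <= Q.
  by rewrite (le_trans tSle)// gerBl sumr_ge0// => h _; rewrite sqr_ge0.
have xM := diffM x (lexx _); have yM := diffM y yQ.
rewrite ler_pdivlMr// ler_pdivlMr// mulrAC (le_trans _ SQ)// mulrC.
rewrite ler_pM2l//.
have -> : (p i j + p j i) * (d i - d j) ^+ 2 * c =
   (p i j + p j i) * (c * (d i - d j) ^+ 2) by ring.
apply: (@le_trans _ _ ((p i j + p j i) * W i j)).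
  by rewrite ler_wpM2l// /W dE winprob_strong.
rewrite /S (bigD1 i)//= (bigD1 j)//= -addrA lerDl addr_ge0// sumr_ge0// => h _.
  by rewrite mulr_ge0.
by rewrite sumr_ge0// => l _; rewrite mulr_ge0.
Qed.

(* Differences [d i - d j] of the errors vanish along the edges of the graph
   with weights [p i j + p j i], hence inside each connected component; the
   errors themselves vanish because they sum to zero on each component. *)
Lemma elo_cvg (R : realType) (n : nat) (p : 'M[R]_n) (x : 'rV[R]_n) (c : R) :
  0 < c -> results p -> (forall i, \sum_j surplus p x i j = 0) ->
  (forall v : 'I_n -> R, (forall i j, 0 < p i j + p j i -> v i = v j) ->
     \sum_i v i * x ord0 i = 0) ->
  cvg1 (fun l : nat => elo (c * l%:R) p) x.
Proof.
move=> c0 hp Fx0 xorth; have [K KP] := dist_to_equilibrium hp Fx0.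
(* At [l = 0] the scale is zero and [elo_spec] does not apply, so the estimates are made for large
   [l]. *)
have cl0 : \forall l \near \oo, 0 < c * l%:R.
  by near=> l; rewrite mulr_gt0// ltr0n; near: l; exists 1%N.
pose d (l : nat) (i : 'I_n) := elo (c * l%:R) p ord0 i - x ord0 i.
pose e := [rel i j : 'I_n | 0 < p i j + p j i].
have d_edge i j : e i j -> d l i - d l j @[l --> \oo] --> (0 : R).
  move=> /= eij; apply/cvgr0Pnorm_lt => eps eps0.
  have B0 : 0 < (p i j + p j i) * eps ^+ 2 by rewrite mulr_gt0 ?exprn_gt0.
  have Kl0 : K / (c * l%:R) @[l --> \oo] --> (0 : R).
    rewrite -[X in _ --> X](mulr0 (K / c)).
    under eq_fun do rewrite invfM mulrA.
    apply: cvgMl_tmp.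
    apply/gtr0_cvgV0; last exact: cvgr_idn.
    by near=> l; rewrite ltr0n; near: l; exists 1%N.
  near=> l; have l0 : 0 < c * l%:R by near: l; exact: cl0.
  have Kl : K / (c * l%:R) < (p i j + p j i) * eps ^+ 2.
    by near: l; exact: (cvgr_lt _ Kl0).
  have := le_lt_trans (KP _ _ l0 (elo_spec l0 hp) i j) Kl.
  rewrite ltr_pM2l// -/(d l i) -/(d l j) => dlt.
  by rewrite -(@ltr_pXn2r _ 2) ?nnegrE ?(ltW eps0)// real_normK ?num_real.
have d_connect i j : connect e i j -> d l i - d l j @[l --> \oo] --> (0 : R).
  move=> /connectP[s]; elim: s i => [i _ ->|h s IH i /= /andP[eih hs] js].
    by under eq_fun do rewrite subrr; exact: cvg_cst.
  have -> : (fun l => d l i - d l j) =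
      (fun l => (d l i - d l h) + (d l h - d l j)).
    by apply/funext => l; ring.
  by rewrite -[0]addr0; apply: cvgD; [exact: d_edge|exact: IH].
have e_sym : connect_sym e.
  by apply: sym_connect_sym => i j /=; rewrite addrC.
have d_cvg i : d l i @[l --> \oo] --> (0 : R).
  (* [v] marks the component of [i]. The errors sum to zero there for large [l], so averaging
     [d l i - d l j] over its members [j] returns [d l i]. *)
  pose v j : R := (connect e i j)%:R.
  have vE h l : 0 < p h l + p l h -> v h = v l.
    by move=> ehl; rewrite /v (same_connect1r e_sym (y := l)).
  have N0 : \sum_j v j != 0.
    rewrite gt_eqF// (bigD1 i)//= ltr_pwDl//; first by rewrite /v connect0.
    by rewrite sumr_ge0// => j _; rewrite ler0n.
  have dE : \forall l \near \oo,
      (\sum_j v j)^-1 * (\sum_j v j * (d l i - d l j)) = d l i.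
    near=> l; have l0 : 0 < c * l%:R by near: l; exact: cl0.
    have -> : \sum_j v j * (d l i - d l j) = (\sum_j v j) * d l i.
      rewrite mulr_suml; apply/eqP; rewrite -subr_eq0 -sumrB.
      have -> : \sum_j (v j * (d l i - d l j) - v j * d l i) =
          \sum_j v j * x ord0 j - \sum_j v j * elo (c * l%:R) p ord0 j.
        by rewrite -sumrB; apply: eq_bigr => j _; rewrite /d; ring.
      rewrite xorth// sub0r oppr_eq0 (elo_spec l0 hp).
      under eq_bigr do rewrite elo_clE mulrCA.
      by rewrite -mulr_sumr surplus_conserved// mulr0.
    by rewrite mulKf.
  apply: cvg_trans (near_eq_cvg dE) _.
  have : \sum_j v j * (d l i - d l j) @[l --> \oo] --> \sum_(j < n) (0 : R).
    apply: cvg_big => [|j _]; first exact: add_continuous.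
    rewrite /v; case: (boolP (connect e i j)) => [/d_connect dij|_].
      by under eq_fun do rewrite mul1r.
    by under eq_fun do rewrite mul0r; exact: cvg_cst.
  by rewrite big1// => /(cvgMl_tmp (a := (\sum_j v j)^-1)); rewrite mulr0.
rewrite /cvg1 /norm1.
rewrite [X in _ --> X](_ : _ = \sum_(i < n) 0); last by rewrite big1.
apply: cvg_big => [|i _]; first exact: add_continuous.
by under eq_fun do rewrite rowB; have /cvg_norm := d_cvg i; rewrite normr0.
Unshelve. all: by end_near.
Qed.

Lemma surplus_cvg (R : realType) (n : nat) (p : 'M[R]_n)
    (u : nat -> 'rV[R]_n) (x : 'rV[R]_n) i j :
  (forall h, u l ord0 h @[l --> \oo] --> x ord0 h) ->
  surplus p (u l) i j @[l --> \oo] --> surplus p x i j.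
Proof.
move=> ux; apply: cvgB; first exact: cvg_cst.
apply: cvgMl_tmp; apply: cvgV; first by rewrite gt_eqF// addr_gt0// expR_gt0.
apply: cvgD; first exact: cvg_cst.
by apply: (continuous_cvg _ (@continuous_expR R _)); exact: cvgB.
Qed.

Theorem corollary4p9 (R : realType) (n : nat) (hn : (2 <= n)%N)
  (p : 'M[R]_n) (hp : results p) (k : R) (hk : 0 < k)
  (u : nat -> 'rV[R]_n) (hu0 : u 0%N = 0)
  (huS : forall l : nat, u l.+1 = u l + elo_cl k (u l) p)
  (x : 'rV[R]_n) (hx : ratings x) (hux : cvg1 u x) :
  cvg1 (fun l : nat => elo l%:R p) x /\
  cvg1 (fun l : nat => elo k (l%:R *: p)) x.
Proof.
have ux i : u l ord0 i @[l --> \oo] --> x ord0 i.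
  move/cvg1P : hux => ux.
  exact: (cvg_comp _ _ ux (@coord_continuous _ _ _ ord0 i x)).
have uS l i : u l.+1 ord0 i = u l ord0 i + k * \sum_j surplus p (u l) i j.
  by rewrite huS -elo_clE mxE.
(* The increments of a convergent sequence tend to zero, and by continuity also to their value at
   [x]. *)
have Fx0 i : \sum_j surplus p x i j = 0.
  have Fu : k * \sum_j surplus p (u l) i j @[l --> \oo] -->
      k * \sum_j surplus p x i j.
    apply: cvgMl_tmp; apply: cvg_big => [|j _]; first exact: add_continuous.
    exact: surplus_cvg.
  have Fu0 : k * \sum_j surplus p (u l) i j @[l --> \oo] --> (0 : R).
    have -> : (fun l => k * \sum_j surplus p (u l) i j) =
        (fun l => u l.+1 ord0 i - u l ord0 i).
      by apply/funext => l; rewrite uS addrC addKr.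
    rewrite -[0](subrr (x ord0 i)); apply: cvgB => //.
    by rewrite (cvg_shiftS (fun l => u l ord0 i)).
  have /eqP : k * \sum_j surplus p x i j = 0.
    exact: (cvg_unique (@Rhausdorff R) Fu Fu0).
  by rewrite mulf_eq0 (gt_eqF hk) => /eqP.
(* The sequence starts at zero and its increments are conserved on components; the limit inherits
   this, which singles [x] out among the equilibria. *)
have xorth (v : 'I_n -> R) : (forall i j, 0 < p i j + p j i -> v i = v j) ->
    \sum_i v i * x ord0 i = 0.
  move=> vE; have vu0 l : \sum_i v i * u l ord0 i = 0.
    elim: l => [|l IH]; first by rewrite big1// => i _; rewrite hu0 mxE mulr0.
    under eq_bigr do rewrite uS mulrDr mulrCA.
    by rewrite big_split/= IH -mulr_sumr surplus_conserved// mulr0 addr0.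
  have : \sum_i v i * u l ord0 i @[l --> \oo] --> \sum_i v i * x ord0 i.
    apply: cvg_big => [|i _]; first exact: add_continuous.
    exact: cvgMl_tmp.
  under eq_fun do rewrite vu0.
  move=> /(cvg_unique (@Rhausdorff R))vx; apply: vx; exact: cvg_cst.
split.
  by under eq_fun do rewrite -[_%:R]mul1r; exact: elo_cvg.
by under eq_fun do rewrite elo_scale; exact: elo_cvg.
Qed.
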